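(* Let $(F,A)$ and $(G,B)$ be two soft sets over a universal set $X$, where $X$, $A$, $B$ are finite nonempty sets with fixed orderings of their elements. Then: (i) $0\le \mathrm{Sim}\{(F,A),(G,B)\}\le 1$; (ii) $\mathrm{Sim}\{(F,A),(G,B)\}=\mathrm{Sim}\{(G,B),(F,A)\}$; (iii) $\mathrm{Sim}\{(F,A),(F,A)\}=1$.
   Context: A soft set over a set $X$ is a pair $(S,A)$ where $A$ is a set (of attributes) and $S:A\to 2^X$ is a map to the subsets of $X$. Given orderings $X=\{x_1,\dots,x_m\}$ and $A=\{a_1,\dots,a_n\}$, the matrix of $(S,A)$ is the $m\times n$ matrix with $(i,j)$ entry $1$ if $x_i\in S(a_j)$ and $0$ otherwise. Similarity measure: let $|X|=m$, $|A|=n$, $|B|=p$, let $Y=(y_{ij})_{m\times n}$ and $Z=(z_{ij})_{m\times p}$ be the matrices of $(F,A)$ and $(G,B)$ (with respect to the same ordering of $X$ and the fixed orderings of $A$ and $B$). Case $n=p$: put $d_{ij}=1$ if $y_{ij}=z_{ij}$ and $d_{ij}=0$ otherwise ($1\le i\le m$, $1\le j\le n$), and $\mathrm{Sim}\{(F,A),(G,B)\}=\frac{\sum_{i,j}d_{ij}}{|X|\cdot|A|}$. Case $n>p$: put $d_{ij}=1$ if $y_{ij}=z_{ij}$ and $d_{ij}=0$ otherwise for $1\le i\le m$, $1\le j\le p$; and put $c_{ij}=1$ if $y_{i,p+j}=0$ and $c_{ij}=0$ otherwise for $1\le i\le m$, $1\le j\le n-p$ (i.e. the surplus columns of the larger matrix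 are compared with a zero matrix). Then $\mathrm{Sim}\{(F,A),(G,B)\}=\frac{\sum_{i,j}d_{ij}+\sum_{i,j}c_{ij}}{|X|\cdot\max\{|A|,|B|\}}$. Case $n<p$: the same with the roles of $(F,A)$ and $(G,B)$ exchanged (the surplus $p-n$ columns of $Z$ are compared with the zero matrix). In (iii) both copies of $(F,A)$ use the same ordering of $A$. *)

(* Defs.v *)
From mathcomp Require Import all_boot all_order all_algebra.

Set Implicit Arguments.
Unset Strict Implicit.
Unset Printing Implicit Defensive.

Import GRing.Theory.

Local Open Scope nat_scope.

(* The pair (S, A) is represented by S alone: its type records A. *)
Definition soft_set (X A : finType) : Type := A -> {set X}.

(* An ordering x_1, ..., x_m of T, without repetition; it lists all of T
   because its length is #|T|. *)
Record ordering (T : finType) : Type := Ordering {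
  ord_tuple :> #|T|.-tuple T;
  ord_uniq : uniq ord_tuple
}.

Definition soft_matrix (X A : finType) (oX : ordering X) (oA : ordering A)
    (S : soft_set X A) : 'M[nat]_(#|X|, #|A|) :=
  \matrix_(i < #|X|, j < #|A|)
    (if tnth oX i \in S (tnth oA j) then 1 else 0).

Definition agreements (m n : nat) (Y Z : 'M[nat]_(m, n)) : nat :=
  \sum_(i < m) \sum_(j < n) (if Y i j == Z i j then 1 else 0).

Definition mx_sim_eq (m n p : nat) (eq_np : n = p)
    (Y : 'M[nat]_(m, n)) (Z : 'M[nat]_(m, p)) : rat :=
  ((agreements (castmx (erefl m, eq_np) Y) Z)%:R / (m * n)%:R)%R.

(* Y is split into its first p columns and its n - p surplus columns, the
   (p + j)-th column of Y being the j-th surplus one. *)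
Definition mx_sim_gt (m n p : nat) (lt_pn : p < n)
    (Y : 'M[nat]_(m, n)) (Z : 'M[nat]_(m, p)) : rat :=
  let Y' : 'M[nat]_(m, p + (n - p)) :=
    castmx (erefl m, esym (subnKC (ltnW lt_pn))) Y in
  ((agreements (lsubmx Y') Z + agreements (rsubmx Y') (const_mx 0))%:R
     / (m * maxn n p)%:R)%R.

Definition mx_sim (m n p : nat)
    (Y : 'M[nat]_(m, n)) (Z : 'M[nat]_(m, p)) : rat :=
  match ltngtP n p with
  | CompareNatEq eq_np => mx_sim_eq eq_np Y Z
  | CompareNatGt lt_pn => mx_sim_gt lt_pn Y Z
  | CompareNatLt lt_np => mx_sim_gt lt_np Z Y
  end.

Definition Sim (X A B : finType) (oX : ordering X)
    (oA : ordering A) (oB : ordering B)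
    (F : soft_set X A) (G : soft_set X B) : rat :=
  mx_sim (soft_matrix oX oA F) (soft_matrix oX oB G).

(* Main.v *)
Require Import Defs.
From mathcomp Require Import all_boot all_order all_algebra.

(** Every similarity is a quotient whose numerator counts agreeing entries and
    whose denominator is the number of entries inspected. A count is at most
    the number of entries inspected, which gives the bounds; in the unequal
    case the two blocks have [p] and [n - p] columns, and [p + (n - p) = n] is
    the larger width ([agreements_le]). Counting agreements is symmetric in
    the two matrices ([agreementsC]); for unequal widths the three-way
    comparison already puts the wider matrix first, so exchanging the
    arguments only exchanges two branches. A matrix agrees with itself
    everywhere ([agreements_id]), so the self-similarity is a nonzero number
    divided by itself; this is where [X] and [A] must be nonempty. *)

Set Implicit Arguments.
Unset Strict Implicit.
Unset Printing Implicit Defensive.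

Import GRing.Theory Num.Theory.

Local Open Scope nat_scope.

Lemma agreementsC m n (Y Z : 'M[nat]_(m, n)) : agreements Y Z = agreements Z Y.
Proof. by do 2![apply: eq_bigr => ? _]; rewrite eq_sym. Qed.

Lemma agreements_le m n (Y Z : 'M[nat]_(m, n)) : agreements Y Z <= m * n.
Proof.
rewrite -[m in m * n]card_ord -sum_nat_const; apply: leq_sum => i _.
rewrite -[n in _ <= n]card_ord -sum1_card; apply: leq_sum => j _.
by case: (_ == _).
Qed.

Lemma agreements_id m n (Y : 'M[nat]_(m, n)) : agreements Y Y = m * n.
Proof.
rewrite -[m in m * n]card_ord -sum_nat_const; apply: eq_bigr => i _.
rewrite -[n in _ = n]card_ord -sum1_card; apply: eq_bigr => j _.
by rewrite eqxx.
Qed.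

Lemma natr_ratio_bounds (a b : nat) :
  a <= b -> (0 <= (a%:R / b%:R : rat) <= 1)%R.
Proof.
move=> le_ab; rewrite divr_ge0 ?ler0n //=.
(* With [b = 0] the quotient takes the default value zero. *)
have [->|b_gt0] := posnP b; first by rewrite invr0 mulr0 ler01.
by rewrite ler_pdivrMr ?ltr0n // mul1r ler_nat.
Qed.

Lemma mx_sim_eq_bounds m n p (eq_np : n = p)
    (Y : 'M[nat]_(m, n)) (Z : 'M[nat]_(m, p)) :
  (0 <= mx_sim_eq eq_np Y Z <= 1)%R.
Proof. by case: p / eq_np Z => Z; apply/natr_ratio_bounds/agreements_le. Qed.

Lemma mx_sim_gt_bounds m n p (lt_pn : p < n)
    (Y : 'M[nat]_(m, n)) (Z : 'M[nat]_(m, p)) :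
  (0 <= mx_sim_gt lt_pn Y Z <= 1)%R.
Proof.
apply: natr_ratio_bounds; rewrite (maxn_idPl (ltnW lt_pn)).
rewrite -[n in _ <= m * n](subnKC (ltnW lt_pn)) mulnDr.
by apply: leq_add; apply: agreements_le.
Qed.

(** The definition branches on a comparison that carries a proof. The next
    two lemmas let any proof of the equality or of the strict inequality
    select the branch, since such proofs are unique; without this the proofs
    produced by comparing [n] with [p] and [p] with [n] could not be
    matched. *)
Lemma mx_simE_eq m n p (eq_np : n = p)
    (Y : 'M[nat]_(m, n)) (Z : 'M[nat]_(m, p)) :
  mx_sim Y Z = mx_sim_eq eq_np Y Z.
Proof.
rewrite /mx_sim; case: (ltngtP n p) => [lt_np|lt_pn|eq_np'].
- by exfalso; rewrite eq_np ltnn in lt_np.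
- by exfalso; rewrite eq_np ltnn in lt_pn.
by rewrite (eq_irrelevance eq_np' eq_np).
Qed.

Lemma mx_simE_neq m n p (lt_pn : p < n)
    (Y : 'M[nat]_(m, n)) (Z : 'M[nat]_(m, p)) :
  (mx_sim Y Z = mx_sim_gt lt_pn Y Z) /\ (mx_sim Z Y = mx_sim_gt lt_pn Y Z).
Proof.
split; rewrite /mx_sim.
  case: (ltngtP n p) => [lt_np|lt_pn'|eq_np].
  - by exfalso; have := ltn_trans lt_np lt_pn; rewrite ltnn.
  - by rewrite (bool_irrelevance lt_pn' lt_pn).
  by exfalso; move: lt_pn; rewrite eq_np ltnn.
case: (ltngtP p n) => [lt_pn'|lt_np|eq_pn].
- by rewrite (bool_irrelevance lt_pn' lt_pn).
- by exfalso; have := ltn_trans lt_np lt_pn; rewrite ltnn.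
by exfalso; move: lt_pn; rewrite eq_pn ltnn.
Qed.

Lemma mx_sim_bounds m n p (Y : 'M[nat]_(m, n)) (Z : 'M[nat]_(m, p)) :
  (0 <= mx_sim Y Z <= 1)%R.
Proof.
have [lt_np|lt_pn|eq_np] := ltngtP n p.
- by rewrite (mx_simE_neq lt_np Z Y).2 mx_sim_gt_bounds.
- by rewrite (mx_simE_neq lt_pn Y Z).1 mx_sim_gt_bounds.
by rewrite (mx_simE_eq eq_np) mx_sim_eq_bounds.
Qed.

Lemma mx_simC m n p (Y : 'M[nat]_(m, n)) (Z : 'M[nat]_(m, p)) :
  mx_sim Y Z = mx_sim Z Y.
Proof.
have [lt_np|lt_pn|eq_np] := ltngtP n p.
- by have [-> ->] := mx_simE_neq lt_np Z Y.
- by have [-> ->] := mx_simE_neq lt_pn Y Z.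
case: p / eq_np Z => Z; rewrite !(mx_simE_eq (erefl n)) /mx_sim_eq.
by rewrite !castmx_id agreementsC.
Qed.

Lemma mx_sim_id m n (Y : 'M[nat]_(m, n)) :
  0 < m -> 0 < n -> mx_sim Y Y = 1%R.
Proof.
move=> m_gt0 n_gt0; rewrite (mx_simE_eq (erefl n)) /mx_sim_eq castmx_id.
by rewrite agreements_id divff // pnatr_eq0 -lt0n muln_gt0 m_gt0.
Qed.

Theorem theorem5p1 (X A B : finType)
    (hX : (0 < #|X|)%N) (hA : (0 < #|A|)%N) (hB : (0 < #|B|)%N)
    (oX : ordering X) (oA : ordering A) (oB : ordering B)
    (F : soft_set X A) (G : soft_set X B) :
  (0 <= Sim oX oA oB F G <= 1)%R /\
  Sim oX oA oB F G = Sim oX oB oA G F /\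
  Sim oX oA oA F F = 1%R.
Proof.
split; first exact: mx_sim_bounds.
by split; [apply: mx_simC | apply: mx_sim_id].
Qed.
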